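(* Let $D$ be an additively idempotent division semiring. Then: (1) A left $D$-semimodule $M$ is e-injective if and only if $M$ has an infinite element. (2) Every left $D$-semimodule can be embedded in an e-injective left $D$-semimodule. (3) Every injective left $D$-semimodule is e-injective. (4) Every finite left $D$-semimodule is e-injective. (5) The regular left $D$-semimodule ${}_DD$ is e-injective if and only if $D\simeq\mathbf{B}$ (and therefore, every finitely generated left $D$-semimodule is e-injective if and only if $D\simeq\mathbf{B}$).
   Context: A semiring is $(S,+,\cdot,0,1)$ with $(S,+,0)$ a commutative monoid, $(S,\cdot,1)$ a monoid, multiplication distributing over addition on both sides, and $0s=0=s0$ for all $s$. It is a division semiring if $(S\setminus\{0\},\cdot,1)$ is a group, and additively idempotent if $s+s=s$ for all $s\in S$. $\mathbf{B}=\{0,1\}$ is the Boolean semifield, with $1+1=1$. A left $S$-semimodule is a commutative monoid $(M,+,0)$ with a scalar multiplication $S\times M\to M$ satisfying $(ss')m=s(s'm)$, $s(m+m')=sm+sm'$, $(s+s')m=sm+s'm$, $1m=m$, $s0=0=0m$. Homomorphisms preserve $+$, $0$ and scalar multiplication; ${}_S\mathcal{M}$ is the category of left $S$-semimodules and $\mathcal{M}$ the category of commutative monoids. An element $\infty\in M$ is infinite if $\infty+m=\infty$ for all $m\in M$. A left $S$-semimodule is finitely generated if it is a homomorphic image of a free semimodule $({}_SS)^n$ with $n$ finite. $M\in{}_S\mathcal{M}$ is injective if for every injective homomorphism $\mu:A\to B$ in ${}_S\mathcal{M}$ and every homomorphism $f:A\to M$ there is a homomorphism $\tilde f:B\to M$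 with $\tilde f\mu=f$. A sequence $0\to A\xrightarrow{f}B\xrightarrow{g}C\to 0$ in ${}_S\mathcal{M}$ (or in $\mathcal{M}$) is short exact if $f$ is a categorical kernel of $g$ and $g$ is a categorical cokernel of $f$ (kernels and cokernels in the sense of categories with zero morphisms). $M\in{}_S\mathcal{M}$ is e-injective if the contravariant functor $\mathrm{Hom}_S(-,M):{}_S\mathcal{M}\to\mathcal{M}$ sends every short exact sequence $0\to A\to B\to C\to 0$ to a short exact sequence $0\to\mathrm{Hom}_S(C,M)\to\mathrm{Hom}_S(B,M)\to\mathrm{Hom}_S(A,M)\to 0$ in $\mathcal{M}$. *)

(* Defs.v *)
From HB Require Import structures.
From mathcomp Require Import all_boot all_order all_algebra.
From mathcomp Require Import boolp classical_sets functions cardinality.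

Set Implicit Arguments.
Unset Strict Implicit.
Unset Printing Implicit Defensive.

Import GRing.Theory.
Local Open Scope ring_scope.
Local Open Scope classical_set_scope.

(* Conventions: a semiring is a [pzSemiRingType], a left S-semimodule is an
   [lSemiModType S] (the axiom [a *: 0 = 0] is derivable there), homomorphisms
   of semimodules and of commutative monoids are [{linear _ -> _}] and
   [{additive _ -> _}].  The [choiceType] structure these carry is no
   restriction, since every type has one by [gen_choiceMixin].  Equality of
   homomorphisms is pointwise equality [=1]. *)

Definition division_semiring (S : pzSemiRingType) : Prop :=
  [/\ (1 : S) <> 0,
      forall x y : S, x <> 0 -> y <> 0 -> x * y <> 0 &
      forall x : S, x <> 0 -> exists y : S, [/\ y <> 0, y * x = 1 & x * y = 1]].

Definition additively_idempotent (S : pzSemiRingType) : Prop :=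
  forall s : S, s + s = s.

(* The library's ring structure on [bool] is the field with two elements
   (addition is [addb]), so the Boolean semifield lives on an alias. *)
Definition Bsemifield : Type := bool.
HB.instance Definition _ := Choice.on Bsemifield.
HB.instance Definition _ := GRing.isPzSemiRing.Build Bsemifield
  orbA orbC orFb andbA andTb andbT andb_orl andb_orr andFb andbF.

Definition semiring_isomorphic (S T : pzSemiRingType) : Prop :=
  exists f : {rmorphism S -> T}, bijective f.

Section Semimodules.
Variable S : pzSemiRingType.

Definition infinite_element (M : lSemiModType S) (oo : M) : Prop :=
  forall m : M, oo + m = oo.

Definition finite_semimodule (M : lSemiModType S) : Prop :=
  finite_set [set: M].

Definition finitely_generated (M : lSemiModType S) : Prop :=
  exists (n : nat) (p : {linear {ffun 'I_n -> S^o} -> M}),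
    forall m : M, exists x, p x = m.

Definition injective_semimodule (M : lSemiModType S) : Prop :=
  forall (A B : lSemiModType S) (mu : {linear A -> B}) (f : {linear A -> M}),
    injective mu -> exists f' : {linear B -> M}, f' \o mu =1 f.

Definition is_kernel (A B C : lSemiModType S)
    (f : {linear A -> B}) (g : {linear B -> C}) : Prop :=
  g \o f =1 \0 /\
  forall (X : lSemiModType S) (h : {linear X -> B}), g \o h =1 \0 ->
    exists h' : {linear X -> A}, f \o h' =1 h /\
      forall h'' : {linear X -> A}, f \o h'' =1 h -> h'' =1 h'.

Definition is_cokernel (A B C : lSemiModType S)
    (f : {linear A -> B}) (g : {linear B -> C}) : Prop :=
  g \o f =1 \0 /\
  forall (X : lSemiModType S) (h : {linear B -> X}), h \o f =1 \0 ->
    exists h' : {linear C -> X}, h' \o g =1 h /\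
      forall h'' : {linear C -> X}, h'' \o g =1 h -> h'' =1 h'.

(* [0 -> A -f-> B -g-> C -> 0] *)
Definition short_exact (A B C : lSemiModType S)
    (f : {linear A -> B}) (g : {linear B -> C}) : Prop :=
  is_kernel f g /\ is_cokernel f g.

End Semimodules.

Definition is_kernel_mon (A B C : nmodType)
    (f : {additive A -> B}) (g : {additive B -> C}) : Prop :=
  g \o f =1 \0 /\
  forall (X : nmodType) (h : {additive X -> B}), g \o h =1 \0 ->
    exists h' : {additive X -> A}, f \o h' =1 h /\
      forall h'' : {additive X -> A}, f \o h'' =1 h -> h'' =1 h'.

Definition is_cokernel_mon (A B C : nmodType)
    (f : {additive A -> B}) (g : {additive B -> C}) : Prop :=
  g \o f =1 \0 /\
  forall (X : nmodType) (h : {additive B -> X}), h \o f =1 \0 ->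
    exists h' : {additive C -> X}, h' \o g =1 h /\
      forall h'' : {additive C -> X}, h'' \o g =1 h -> h'' =1 h'.

Definition short_exact_mon (A B C : nmodType)
    (f : {additive A -> B}) (g : {additive B -> C}) : Prop :=
  is_kernel_mon f g /\ is_cokernel_mon f g.

Definition hom_monoid (S : pzSemiRingType) (A M : lSemiModType S) : Type :=
  {linear A -> M}.

Section HomMonoid.
Variables (S : pzSemiRingType) (A M : lSemiModType S).

HB.instance Definition _ := gen_eqMixin (hom_monoid A M).
HB.instance Definition _ := gen_choiceMixin (hom_monoid A M).

Definition hom_fun (h : hom_monoid A M) : A -> M := h : {linear A -> M}.

Lemma hom_ext (h k : hom_monoid A M) : hom_fun h =1 hom_fun k -> h = k.
Proof.
case: h k => [h [[ha] [hs]]] [k [[ka] [ks]]] /= /funext.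
rewrite /hom_fun /= => hk; subst k.
by rewrite (Prop_irrelevance ha ka) (Prop_irrelevance hs ks).
Qed.

Definition hom_zero : hom_monoid A M := (\0 : A -> M) : {linear A -> M}.
Definition hom_add (h k : hom_monoid A M) : hom_monoid A M :=
  (hom_fun h \+ hom_fun k : A -> M) : {linear A -> M}.

Fact hom_addA : associative hom_add.
Proof. by move=> h k l; apply: hom_ext => x; apply: addrA. Qed.
Fact hom_addC : commutative hom_add.
Proof. by move=> h k; apply: hom_ext => x; apply: addrC. Qed.
Fact hom_add0 : left_id hom_zero hom_add.
Proof. by move=> h; apply: hom_ext => x; apply: add0r. Qed.

HB.instance Definition _ :=
  GRing.isNmodule.Build (hom_monoid A M) hom_addA hom_addC hom_add0.

End HomMonoid.

Section Precomposition.
Variables (S : pzSemiRingType) (A B M : lSemiModType S) (f : {linear A -> B}).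

Definition hom_precomp (h : hom_monoid B M) : hom_monoid A M :=
  ((h : {linear B -> M}) \o f : A -> M) : {linear A -> M}.

Fact hom_precomp_is_nmod_morphism : nmod_morphism hom_precomp.
Proof. by split=> [|h k]; apply: hom_ext. Qed.

HB.instance Definition _ :=
  GRing.isNmodMorphism.Build (hom_monoid B M) (hom_monoid A M)
    hom_precomp hom_precomp_is_nmod_morphism.

End Precomposition.

Definition e_injective (S : pzSemiRingType) (M : lSemiModType S) : Prop :=
  forall (A B C : lSemiModType S) (f : {linear A -> B}) (g : {linear B -> C}),
    short_exact f g ->
    short_exact_mon
      (hom_precomp (M:=M) g : {additive hom_monoid C M -> hom_monoid B M})
      (hom_precomp (M:=M) f : {additive hom_monoid B M -> hom_monoid A M}).

(* Main.v *)
(** In a semimodule over an additively idempotent division semiring, a sum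
    vanishes only if both summands do, and nonzero scalars reflect zero.  Hence,
    if [oo] is infinite in [M], any homomorphism into [M] defined on the kernel
    of [g : B -> C] extends to [B] by the value [oo] off the kernel; and two
    extensions become equal after adding the map [C -> M] that sends every
    nonzero element to [oo].  This makes [M] e-injective.  Conversely, let
    [M + {oo}] be [M] with an infinite element adjoined: [M] is the kernel of
    [M + {oo} -> 0 + {oo}], which is also the cokernel of the inclusion, and a
    retraction of [M + {oo}] onto [M] sends [oo] to an infinite element of [M].
    Finally, an infinite element of [D] absorbs nonzero scalars, so it is an
    idempotent of the group [D \ {0}], and then every nonzero element is [1]. *)

Require Import Defs.
From HB Require Import structures.
From mathcomp Require Import all_boot all_order all_algebra.
From mathcomp Require Import boolp classical_sets functions cardinality.

Set Implicit Arguments.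
Unset Strict Implicit.
Unset Printing Implicit Defensive.

Import GRing.Theory.
Local Open Scope ring_scope.

(** Zero needs no hypothesis of its own, since [h 0 = h (0 *: 0) = 0 *: h 0]. *)
Lemma linear_ex (S : pzSemiRingType) (A B : lSemiModType S) (h : A -> B) :
  {morph h : x y / x + y} -> (forall s, {morph h : x / s *: x}) ->
  exists h' : {linear A -> B}, h' =1 h.
Proof.
move=> hD hZ; have h0 : h 0 = 0 by rewrite -(scale0r (0 : A)) hZ scale0r.
have hN : nmod_morphism h by split.
pose mD := GRing.isNmodMorphism.Build A B h hN.
pose mZ := GRing.isScalable.Build S A B *:%R h hZ.
pose h' : {linear A -> B} := HB.pack h mD mZ.
by exists h'.
Qed.

(** * Categorical kernels are injective with image the null set *)

Section Kernels.
Variables (S : pzSemiRingType) (A B C : lSemiModType S).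
Variables (f : {linear A -> B}) (g : {linear B -> C}).
Hypothesis ker_fg : is_kernel f g.

(** The regular semimodule is free on [1], so maps out of it stand for elements of [X] and turn
    universal properties into statements on elements. *)
Lemma orbit_linear_ex (X : lSemiModType S) (x : X) :
  exists h : {linear S^o -> X}, forall s : S, h s = s *: x.
Proof.
by apply: linear_ex => [s t|s t]; rewrite ?scalerDl// -scalerA.
Qed.

(** If [f a = f a'], the orbit maps of [a] and [a'] both factor the orbit map of [f a] through [f];
    uniqueness and evaluation at [1] give [a = a']. *)
Lemma is_kernel_inj : injective f.
Proof.
move=> a a' faa'; have [h hE] := orbit_linear_ex a.
have [h' h'E] := orbit_linear_ex a'; have [k kE] := orbit_linear_ex (f a).
have [gf0 univ] := ker_fg; have {}gf0 : g (f a) = 0 := gf0 a.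
have [|l [_ luniq]] := univ S^o k.
  by move=> s /=; rewrite kE linearZ /= gf0 scaler0.
have <- : h 1 = a by rewrite hE scale1r.
have <- : h' 1 = a' by rewrite h'E scale1r.
by rewrite (luniq h) ?(luniq h') // => s /=; rewrite ?hE ?h'E kE linearZ ?faa'.
Qed.

Lemma is_kernel_preim b : g b = 0 -> exists a, f a = b.
Proof.
move=> gb0; have [k kE] := orbit_linear_ex b.
have [_ univ] := ker_fg; have [|l [lE _]] := univ S^o k.
  by move=> s /=; rewrite kE linearZ /= gb0 scaler0.
by exists (l 1); rewrite [LHS]lE kE scale1r.
Qed.

End Kernels.

(** * Surjectivity of cokernels of commutative monoids *)

Section Image.
Variables (X Y : nmodType) (p : {additive X -> Y}).

Definition image_pred : pred Y := fun y => `[< exists x, p x = y >].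

Fact image_pred_closed : addr_closed image_pred.
Proof.
split; first by apply/asboolP; exists 0; rewrite raddf0.
move=> _ _ /asboolP[x <-] /asboolP[y <-].
by apply/asboolP; exists (x + y); rewrite raddfD.
Qed.

Record image := Image { image_val : Y; _ : image_pred image_val }.
HB.instance Definition _ := [isSub for image_val].
HB.instance Definition _ := [Choice of image by <:].
HB.instance Definition _ :=
  GRing.SubChoice_isSubNmodule.Build Y image_pred image image_pred_closed.

Lemma in_image x : image_pred (p x).
Proof. by apply/asboolP; exists x. Qed.

Definition corestriction x : image := Image (in_image x).

Fact corestriction_nmod : nmod_morphism corestriction.
Proof. by split=> [|x y]; apply: val_inj => /=; rewrite ?raddf0 ?raddfD. Qed.

HB.instance Definition _ :=
  GRing.isNmodMorphism.Build X image corestriction corestriction_nmod.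

End Image.

(* [p] factors as [i \o s \o p] through the inclusion [i] of its own image, and
   uniqueness of factorizations through a cokernel gives [i \o s = id]. *)
Lemma is_cokernel_mon_surj (X Y Z : nmodType) (q : {additive Z -> X})
    (p : {additive X -> Y}) :
  is_cokernel_mon q p -> forall y, exists x, p x = y.
Proof.
move=> [pq0 univ].
have [|s [sp _]] := univ (image p) (corestriction p).
  by move=> z; apply: val_inj; exact: pq0.
have [|t [_ tuniq]] := univ Y p; first exact: pq0.
pose i : {additive image p -> Y} := val.
have is_t := tuniq (i \o s : {additive Y -> Y}).
have id_t := tuniq (idfun : {additive Y -> Y}).
move=> y; have : i (s y) = y.
  rewrite [LHS]is_t => [|x]; first exact/esym/id_t.
  exact: (congr1 val (sp x)).
by case: (s y) => z /= /asboolP[x <-] <-; exists x.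
Qed.

(** * An infinite element implies e-injectivity *)

Section InfiniteElements.
Variable D : pzSemiRingType.
Hypotheses (divD : division_semiring D) (idemD : additively_idempotent D).

Lemma semimodule_addrr (M : lSemiModType D) (m : M) : m + m = m.
Proof. by rewrite -{1 2}[m]scale1r -scalerDl idemD scale1r. Qed.

Lemma semimodule_addr_eq0 (M : lSemiModType D) (x y : M) :
  (x + y == 0) = (x == 0) && (y == 0).
Proof.
apply/eqP/andP => [xy0|[/eqP-> /eqP->]]; last by rewrite addr0.
split; apply/eqP.
  by rewrite -[x]addr0 -xy0 addrA semimodule_addrr.
by rewrite -[y]addr0 -xy0 addrCA semimodule_addrr.
Qed.

Lemma semimodule_scaler_eq0 (M : lSemiModType D) (s : D) (x : M) :
  (s *: x == 0) = (s == 0) || (x == 0).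
Proof.
have [->|s0] := eqVneq s 0; first by rewrite scale0r eqxx.
apply/eqP/eqP => [sx0|->]; last by rewrite scaler0.
have [_ _ /(_ s) []] := divD; first exact/eqP.
by move=> t [_ ts1 _]; rewrite -[x]scale1r -ts1 -scalerA sx0 scaler0.
Qed.

Lemma division_mulr_eq0 (s t : D) : (s * t == 0) = (s == 0) || (t == 0).
Proof. exact: (semimodule_scaler_eq0 s (t : D^o)). Qed.

Lemma idempotent_addr_eq0 (s t : D) : (s + t == 0) = (s == 0) && (t == 0).
Proof. exact: (semimodule_addr_eq0 (s : D^o) t). Qed.

(** Every [m] is [s *: (t *: m)] with [t] inverse to [s], so [s *: oo] is infinite too, and two
    infinite elements absorb each other. *)
Lemma infinite_scale (M : lSemiModType D) (oo : M) (s : D) :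
  infinite_element oo -> s != 0 -> s *: oo = oo.
Proof.
move=> ooP /eqP s0; have [_ _ /(_ s s0) [t [_ _ st1]]] := divD.
have sooP m : s *: oo + m = s *: oo.
  by rewrite -[m]scale1r -st1 -scalerA -scalerDr ooP.
by rewrite -(sooP oo) addrC ooP.
Qed.

Lemma infinite_extension (B C M : lSemiModType D) (oo : M)
    (g : {linear B -> C}) (h : B -> M) :
    infinite_element oo ->
    (forall x y, g x = 0 -> g y = 0 -> h (x + y) = h x + h y) ->
    (forall s x, g x = 0 -> h (s *: x) = s *: h x) ->
  exists k : {linear B -> M}, k =1 fun b => if g b == 0 then h b else oo.
Proof.
move=> ooP hD hZ; apply: linear_ex => [x y|s x].
  rewrite linearD semimodule_addr_eq0.
  have [gx0|_] := eqVneq (g x) 0; last by rewrite ooP.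
  by have [gy0|_] := eqVneq (g y) 0; rewrite /= ?hD// addrC ooP.
rewrite linearZ_LR semimodule_scaler_eq0 orbC.
have [gx0|_] := eqVneq (g x) 0; rewrite /=; first by rewrite hZ.
have [->|s0] := eqVneq s 0; last by rewrite infinite_scale.
by rewrite scale0r -(scale0r (0 : B)) hZ ?linear0// !scale0r.
Qed.

Lemma infinite_e_injective (M : lSemiModType D) (oo : M) :
  infinite_element oo -> e_injective M.
Proof.
move=> ooP A B C f g [kfg [gf0 cok]].
have {}gf0 a : g (f a) = 0 := gf0 a.
have finj := is_kernel_inj kfg; have fpre := is_kernel_preim kfg.
have h0 (h : {linear C -> M}) : forall a, h (g (f a)) = 0.
  by move=> a; rewrite gf0 linear0.
have gsur (k : hom_monoid B M) : k \o f =1 \0 ->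
    exists l : hom_monoid C M, hom_precomp g l = k.
  by move=> /cok[l [lE _]]; exists l; apply: hom_ext.
(* Both [l] and [l'] factor [l \o g] through the cokernel [g]. *)
have gepi : injective (hom_precomp (M := M) g).
  move=> l l' /(congr1 (@hom_fun _ _ _)) E; apply: hom_ext.
  have [|k [_ kuniq]] := cok M ((l : {linear C -> M}) \o g : {linear B -> M}).
    by move=> a /=; rewrite h0.
  have lk := kuniq l (fun _ => erefl).
  have l'k := kuniq l' (fun b => esym (congr1 (fun u => u b) E)).
  by move=> c; rewrite /hom_fun lk l'k.
have fsur (a : hom_monoid A M) : exists b : hom_monoid B M, hom_precomp f b = a.
  (* Inverse of [f] on its image followed by [a]; the default [0] is never seen, as the extension
     takes the value [oo] there. *)
  pose h b := match pselect (exists x, f x = b) with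
              | left e => a (projT1 (cid e)) | right _ => 0 end.
  have hf x : h (f x) = a x.
    rewrite /h; case: pselect => [e|[]]; last by exists x.
    by case: cid => y /= /finj ->.
  have [||k kE] := @infinite_extension B C M oo g h ooP.
  - by move=> _ _ /fpre[x <-] /fpre[y <-]; rewrite -linearD !hf linearD.
  - by move=> s _ /fpre[x <-]; rewrite -linearZ !hf linearZ.
  exists k; apply: hom_ext => x.
  by rewrite /hom_fun /= kE gf0 eqxx hf.
(* [k] sends [0] to [0] and every other element of [C] to [oo]. *)
have [||k kE] := @infinite_extension C C M oo idfun (fun=> 0) ooP.
- by move=> *; rewrite addr0.
- by move=> *; rewrite scaler0.
(* On the image of [f] the two maps agree; elsewhere both sums equal [oo]. *)
have glue (h h' : hom_monoid B M) : hom_precomp f h = hom_precomp f h' ->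
    h + hom_precomp g k = h' + hom_precomp g k.
  move=> E; apply: hom_ext => b.
  change (h b + k (g b) = h' b + k (g b)).
  rewrite kE /=; have [/fpre[a <-]|_] := eqVneq (g b) 0.
    by have /= := congr1 (fun u => hom_fun u a) E; rewrite /hom_fun /= => ->.
  by rewrite addrC ooP addrC ooP.
split; split.
- by move=> l; apply: hom_ext => a; apply: h0.
- move=> X h hf0.
  have /choice[l lE] : forall x, exists l, hom_precomp g l = h x.
    move=> x; apply: gsur => a.
    by have := congr1 (fun u => hom_fun u a) (hf0 x).
  have lN : nmod_morphism l.
    split=> [|x y]; apply: gepi; first by rewrite lE !raddf0.
    by rewrite lE !raddfD /= !lE.
  pose mD := GRing.isNmodMorphism.Build X (hom_monoid C M) l lN.
  pose l' : {additive X -> hom_monoid C M} := HB.pack l mD.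
  exists l'; split=> [x|l'' l''E x]; first exact: lE.
  by apply: gepi; rewrite [LHS]l''E [RHS]lE.
- by move=> l; apply: hom_ext => a; apply: h0.
move=> X h hg0.
have /choice[e eE] := fsur.
(* As [h] kills [hom_precomp g k], it depends only on restrictions along [f], so it descends along
   any choice [e] of extensions. *)
have hE u v : hom_precomp f u = hom_precomp f v -> h u = h v.
  move=> /glue/(congr1 h); rewrite !raddfD.
  by rewrite [h (hom_precomp g k)]hg0 /= !addr0.
have lN : nmod_morphism (h \o e).
  split=> [|x y] /=; first by rewrite -(raddf0 h); apply: hE; rewrite eE raddf0.
  by rewrite -raddfD; apply: hE; rewrite raddfD /= !eE.
pose mD := GRing.isNmodMorphism.Build (hom_monoid A M) X (h \o e) lN.
pose l : {additive hom_monoid A M -> X} := HB.pack (h \o e) mD.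
exists l; split=> [b|l' l'E a]; first by apply: hE; rewrite eE.
by rewrite -[a in LHS]eE [LHS]l'E.
Qed.

End InfiniteElements.

(* The hypotheses on [D] are parameters of the alias because they are needed
   for its semimodule structure. *)
Definition adjoin_infinity (D : pzSemiRingType)
  (divD : division_semiring D) (idemD : additively_idempotent D)
  (M : lSemiModType D) : Type := option M.

(** * Adjoining an infinite element *)

Section AdjoinInfinity.
Variable D : pzSemiRingType.
Hypotheses (divD : division_semiring D) (idemD : additively_idempotent D).
Variable M : lSemiModType D.
Local Notation Moo := (adjoin_infinity divD idemD M).

HB.instance Definition _ := Choice.on Moo.

Definition oo_add (x y : Moo) : Moo :=
  if x is Some a then if y is Some b then Some (a + b) else None else None.

Fact oo_addA : associative oo_add.
Proof. by move=> [x|] [y|] [z|] //=; rewrite addrA. Qed.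
Fact oo_addC : commutative oo_add.
Proof. by move=> [x|] [y|] //=; rewrite addrC. Qed.
Fact oo_add0 : left_id (Some 0 : Moo) oo_add.
Proof. by move=> [x|] //=; rewrite add0r. Qed.

HB.instance Definition _ :=
  GRing.isNmodule.Build Moo oo_addA oo_addC oo_add0.

(** The axiom [0 *: x = 0] forces the exception at [s = 0]; nonzero scalars must fix an infinite
    element. *)
Definition oo_scale (s : D) (x : Moo) : Moo :=
  if x is Some a then Some (s *: a) else if s == 0 then Some 0 else None.

Fact oo_scaleA s t x : oo_scale s (oo_scale t x) = oo_scale (s * t) x.
Proof.
case: x => [x|] /=; first by rewrite scalerA.
rewrite division_mulr_eq0// orbC.
by case: (t == 0) => //=; rewrite scaler0.
Qed.
Fact oo_scale0 x : oo_scale 0 x = 0.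
Proof. by case: x => [x|] /=; rewrite ?scale0r ?eqxx. Qed.
Fact oo_scale1 : left_id 1 oo_scale.
Proof.
case=> [x|] /=; first by rewrite scale1r.
by have [/eqP/negPf-> _ _] := divD.
Qed.
Fact oo_scaleDr : right_distributive oo_scale +%R.
Proof.
move=> s [x|] [y|] //=; rewrite -?[oo_add _ _]/(_ + _) ?scalerDr//.
- by case: eqVneq => //= ->; rewrite /GRing.add/= scale0r addr0.
- by case: eqVneq => //= ->; rewrite /GRing.add/= scale0r addr0.
- by case: eqVneq => //= _; rewrite /GRing.add/= addr0.
Qed.
Fact oo_scaleDl x : {morph oo_scale^~ x : s t / s + t}.
Proof.
move=> s t; case: x => [x|] /=; first by rewrite scalerDl.
rewrite idempotent_addr_eq0//.
by do 2![case: (_ == 0)] => //=; rewrite /GRing.add/= addr0.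
Qed.

HB.instance Definition _ := GRing.Nmodule_isLSemiModule.Build D Moo
  oo_scaleA oo_scale0 oo_scale1 oo_scaleDr oo_scaleDl.

Lemma adjoin_infinity_infinite : infinite_element (None : Moo).
Proof. by []. Qed.

Lemma adjoin_infinity_embedding :
  exists mu : {linear M -> Moo}, forall m, mu m = Some m.
Proof. by apply: linear_ex. Qed.

Lemma infinite_of_retraction (mu : {linear M -> Moo}) (r : {linear Moo -> M}) :
  r \o mu =1 id -> exists oo : M, infinite_element oo.
Proof.
move=> rK; exists (r None) => m.
by rewrite -{1}[m]rK /= -linearD adjoin_infinity_infinite.
Qed.

End AdjoinInfinity.

(** * Characterizations by infinite elements, and the regular semimodule *)

Section Characterizations.
Variable D : pzSemiRingType.
Hypotheses (divD : division_semiring D) (idemD : additively_idempotent D).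

Lemma adjoin_infinity_short_exact (M : lSemiModType D)
    (mu : {linear M -> adjoin_infinity divD idemD M}) :
    (forall m, mu m = Some m) ->
  exists (C : lSemiModType D)
    (g : {linear adjoin_infinity divD idemD M -> C}), short_exact mu g.
Proof.
move=> muE; pose Moo := adjoin_infinity divD idemD M.
(* Functions on an empty index set form the zero semimodule, so [C] has just the elements [0] and
   [None]. *)
pose Z : lSemiModType D := {ffun 'I_0 -> D^o}.
pose C := adjoin_infinity divD idemD Z; exists C.
have Z0 (z : Z) : z = 0 by apply/ffunP => -[].
have [||g gE] := @linear_ex D Moo C (fun x => if x is Some _ then 0 else None).
- by move=> [x|] [y|] //=; rewrite /GRing.add/= ?addr0.
- by move=> s [x|]; rewrite /GRing.scale /= ?scaler0//; case: eqP.
have gmu0 m : g (mu m) = 0 by rewrite muE gE.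
exists g; split; split=> //.
- move=> X h gh0.
  (* [g] does not vanish at [None], so [h] takes its values in [M]. *)
  have hS x : exists m, h x = Some m.
    by have /= := gh0 x; rewrite gE; case: (h x) => // m _; exists m.
  have /choice[l lE] := hS.
  have [||l' l'E] := @linear_ex D X M l.
  + by move=> x y; apply: Some_inj; rewrite -lE linearD !lE.
  + by move=> s x; apply: Some_inj; rewrite -lE linearZ /= lE.
  exists l'; split=> [x|l'' l''E x]; first by rewrite /= muE l'E lE.
  by apply: Some_inj; rewrite -muE [LHS]l''E l'E lE.
move=> X h hmu0.
have hSome m : h (Some m) = 0 by rewrite -muE [LHS]hmu0.
(* Additivity at [None + None] rests on the idempotence of [h None]. *)
have [||l lE] :=
  @linear_ex D C X (fun c => if c is Some _ then 0 else h None).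
- move=> [x|] [y|]; rewrite ?addr0 ?add0r//=.
  by rewrite semimodule_addrr.
- move=> s [x|]; first by rewrite /= scaler0.
  by rewrite -linearZ /= /GRing.scale /=; case: eqP.
exists l; split=> [[m|]|l'' l''E [c|]].
- by rewrite /= gE lE hSome.
- by rewrite /= gE lE.
- by rewrite lE (Z0 c) -[LHS](_ : l'' 0 = _)// linear0.
- by rewrite lE -(l''E None) /= gE.
Qed.

(** For the forward direction, e-injectivity makes restriction along [mu] a cokernel, hence
    surjective; an extension of the identity of [M] is the retraction sought. *)
Lemma e_injectiveP (M : lSemiModType D) :
  e_injective M <-> exists oo : M, infinite_element oo.
Proof.
split=> [Minj|[oo]]; last exact: infinite_e_injective.
have [mu muE] := adjoin_infinity_embedding divD idemD M.
have [C [g /Minj[_ /is_cokernel_mon_surj surj]]] :=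
  adjoin_infinity_short_exact muE.
have [r rE] := surj (idfun : {linear M -> M}).
apply: (@infinite_of_retraction _ divD idemD _ mu r) => m.
exact: (congr1 (fun u => hom_fun u m) rE).
Qed.

Lemma injective_infinite (M : lSemiModType D) :
  injective_semimodule M -> exists oo : M, infinite_element oo.
Proof.
move=> Minj; have [mu muE] := adjoin_infinity_embedding divD idemD M.
have [|r rE] := Minj _ _ mu idfun; first by move=> x y; rewrite !muE => -[].
exact: infinite_of_retraction rE.
Qed.

(** The sum of all elements absorbs each of them, because addition is idempotent. *)
Lemma finite_infinite (M : lSemiModType D) :
  finite_semimodule M -> exists oo : M, infinite_element oo.
Proof.
move=> /finite_seqP[s sE]; exists (\sum_(x <- s) x) => m.
have ms : m \in s by have : [set: M]%classic m by []; rewrite sE.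
by rewrite (big_rem m ms) /= addrAC semimodule_addrr.
Qed.

Lemma regular_infiniteP :
  (exists oo : D^o, infinite_element oo) <-> semiring_isomorphic D Bsemifield.
Proof.
have [D1 DM Dinv] := divD; split=> [[w wP]|[f [f' fK f'K]]]; last first.
  exists 1 => m; apply: (can_inj fK); rewrite rmorphD rmorph1.
  by case: (f m).
have w0 : w != 0.
  by apply/eqP => w0; apply: D1; have := wP 1; rewrite w0 add0r.
have w1 : w = 1.
  have ww : (w : D) * w = w by apply: infinite_scale wP w0.
  have [t [_ tw1 _]] := Dinv _ (elimN eqP w0).
  by rewrite -(mul1r (w : D)) -tw1 -mulrA ww.
(* Nonzero scalars fix the infinite element, which is now [1], so [d * 1 = 1]. *)
have d1 (d : D) : d != 0 -> d = 1.
  by move=> /(infinite_scale divD wP); rewrite w1 /GRing.scale /= mulr1.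
pose h (d : D) : Bsemifield := d != 0.
have hN : nmod_morphism h.
  split=> [|x y]; first by rewrite /h eqxx.
  by rewrite /h idempotent_addr_eq0// negb_and.
have hM : monoid_morphism h.
  split=> [|x y]; first by rewrite /h; apply/eqP.
  by rewrite /h division_mulr_eq0// negb_or.
pose mD := GRing.isNmodMorphism.Build D Bsemifield h hN.
pose mM := GRing.isMonoidMorphism.Build D Bsemifield h hM.
pose h' : {rmorphism D -> Bsemifield} := HB.pack h mD mM.
exists h'; exists (fun b : bool => if b then 1 else 0) => [x|[]] /=.
- by rewrite /h; case: eqVneq => [->|/d1->].
- by rewrite /h; apply/eqP.
- by rewrite /h eqxx.
Qed.

(** The constant family [w] is infinite in the free semimodule, and surjections preserve infinite
    elements. *)
Lemma finitely_generated_infinite (M : lSemiModType D) (w : D^o) :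
  infinite_element w -> finitely_generated M ->
  exists oo : M, infinite_element oo.
Proof.
move=> wP [n [p psurj]]; exists (p [ffun=> w]) => m.
have [x <-] := psurj m; rewrite -linearD; congr (p _).
by apply/ffunP => i; rewrite !ffunE wP.
Qed.

Lemma regular_finitely_generated : finitely_generated (D^o : lSemiModType D).
Proof.
have [||p pE] := @linear_ex D {ffun 'I_1 -> D^o} D^o (fun x => x ord0).
- by move=> x y; rewrite ffunE.
- by move=> s x; rewrite ffunE.
by exists 1%N, p => m; exists [ffun=> m]; rewrite pE ffunE.
Qed.

End Characterizations.

Theorem theorem4p4 (D : pzSemiRingType)
    (divD : division_semiring D) (idemD : additively_idempotent D) :
  (forall M : lSemiModType D,
     e_injective M <-> exists oo : M, infinite_element oo)
  /\ (forall M : lSemiModType D,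
     exists (N : lSemiModType D) (mu : {linear M -> N}),
       injective mu /\ e_injective N)
  /\ (forall M : lSemiModType D, injective_semimodule M -> e_injective M)
  /\ (forall M : lSemiModType D, finite_semimodule M -> e_injective M)
  /\ (e_injective (D^o : lSemiModType D) <-> semiring_isomorphic D Bsemifield)
  /\ ((forall M : lSemiModType D, finitely_generated M -> e_injective M)
        <-> semiring_isomorphic D Bsemifield).
Proof.
have einjP := e_injectiveP divD idemD.
have regP := regular_infiniteP divD idemD.
split=> //; split.
  move=> M; have [mu muE] := adjoin_infinity_embedding divD idemD M.
  exists (adjoin_infinity divD idemD M), mu.
  split; first by move=> x y; rewrite !muE => -[].
  by apply/einjP; exists None; apply: adjoin_infinity_infinite.
split; first by move=> M /(injective_infinite divD idemD)/einjP.
split; first by move=> M /(finite_infinite idemD)/einjP.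
split; first exact: iff_trans (einjP _) regP.
split=> [fgP|/regP[w wP] M Mfg]; last first.
  by apply/einjP; apply: finitely_generated_infinite wP Mfg.
apply/regP/(einjP D^o)/fgP; exact: regular_finitely_generated.
Qed.
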